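(* Suppose that $F$ is a finite graph with at least two vertices. Then $\mathsf S_F\equiv_W\mathsf{LPO}$.
   Context: $\equiv_W$ denotes Weihrauch equivalence. Graphs have vertex set $\mathbb N$ (or are countable), given by characteristic functions of their edge sets. $\mathsf S_F$: given a graph $G$, output $1$ if $F$ is isomorphic to an (induced) subgraph of $G$, i.e. there is an injection of the vertices of $F$ into those of $G$ such that two vertices are adjacent in $F$ iff their images are adjacent in $G$, and output $0$ otherwise. $\mathsf{LPO}$: given $p:\mathbb N\to\mathbb N$, output $n$ such that if $n=0$ then $p(j)>0$ for all $j$, and if $n>0$ then $p(n-1)=0$ and $p(t)>0$ for all $t<n-1$. *)

(* Defs.v *)
From mathcomp Require Import all_boot.
From mathcomp Require Import boolp.
From Stdlib Require Import Arith.Cantor.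

Set Implicit Arguments.
Unset Strict Implicit.
Unset Printing Implicit Defensive.

Definition baire := nat -> nat.

Definition cpair (x y : nat) : nat := Cantor.to_nat (x, y).
Definition cfst (z : nat) : nat := (Cantor.of_nat z).1.
Definition csnd (z : nat) : nat := (Cantor.of_nat z).2.

(* Partial recursive functions relative to an oracle in Baire space.  All
   programs are unary: tuples of arguments are coded with [cpair], so that
   [Fst], [Snd] and [Pair] play the role of the projections and of
   substitution with several arguments. *)
Inductive prog : Type :=
| Zero
| Succ
| Fst
| Snd
| Oracle
| Pair of prog & prog
| Comp of prog & prog
| Prec of prog & prog
| Mu of prog.

(* [eval o c] is the graph of the partial function computed by [c]. *)
Fixpoint eval (o : baire) (c : prog) : nat -> nat -> Prop :=
  match c with
  | Zero => fun _ z => z = 0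
  | Succ => fun x z => z = x.+1
  | Fst => fun x z => z = cfst x
  | Snd => fun x z => z = csnd x
  | Oracle => fun x z => z = o x
  | Pair f g => fun x z =>
      exists a b, [/\ eval o f x a, eval o g x b & z = cpair a b]
  | Comp f g => fun x z => exists2 y, eval o g x y & eval o f y z
  | Prec f g => fun x =>
      let a := cfst x in
      (fix rec (n : nat) : nat -> Prop :=
         if n is m.+1
         then fun z => exists2 r, rec m r & eval o g (cpair a (cpair m r)) z
         else eval o f a) (csnd x)
  | Mu f => fun x n =>
      eval o f (cpair x n) 0 /\
      (forall m, m < n -> exists k, eval o f (cpair x m) k.+1)
  end.

Lemma eval_functional o c x y z : eval o c x y -> eval o c x z -> y = z.
Proof.
elim: c x y z => [||||| f IHf g IHg | f IHf g IHg | f IHf g IHg | f IHf] /=.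
1-5: by move=> x y z -> ->.
- move=> x y z [a [b [fa gb ->]]] [a' [b' [fa' gb' ->]]].
  by rewrite (IHf _ _ _ fa fa') (IHg _ _ _ gb gb').
- move=> x y z [a ga fa] [b gb fb].
  by move: fb; rewrite -(IHg _ _ _ ga gb); exact: IHf fa.
- move=> x; elim: (csnd x) => [|n IHn] y z; first exact: IHf.
  move=> [r rn gr] [s sn gs].
  by move: gs; rewrite -(IHn _ _ rn sn); exact: IHg gr.
- move=> x y z [fy ltfy] [fz ltfz]; case: (ltngtP y z) => // [yz|zy].
  + by have [k fk] := ltfz _ yz; have := IHf _ _ _ fy fk.
  + by have [k fk] := ltfy _ zy; have := IHf _ _ _ fz fk.
Qed.

(* The partial functional on Baire space computed by [c]: it is defined at [p]
   iff [c] with oracle [p] halts on every input. *)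
Definition computes (c : prog) (p q : baire) : Prop :=
  forall n, eval p c n (q n).

Definition bpair (p q : baire) : baire :=
  fun n => if odd n then q n./2 else p n./2.

(* [names] is the graph of the representation, a partial surjection from
   Baire space. *)
Record repSpace := RepSpace {
  point :> Type;
  names : baire -> point -> Prop;
  names_functional : forall p x y, names p x -> names p y -> x = y;
  names_surjective : forall x, exists p, names p x }.

(* Partial multivalued functions between represented spaces. *)
Definition problem (X Y : repSpace) := X -> Y -> Prop.

Definition pdom (X Y : repSpace) (f : problem X Y) (x : X) : Prop :=
  exists y, f x y.

(* [Phi] turns instances of [f] into instances of [g]; [Psi], given the
   original instance and any solution of the new one, returns a solution of
   the original.  All of this happens on names. *)
Definition weihrauch_le (X Y U V : repSpace)
    (f : problem X Y) (g : problem U V) : Prop :=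
  exists Phi Psi : prog,
  forall (p : baire) (x : X), names p x -> pdom f x ->
  exists (p' : baire) (u : U),
    [/\ computes Phi p p', names p' u, pdom g u &
     forall (q : baire) (v : V), names q v -> g u v ->
     exists (r : baire) (y : Y),
       [/\ computes Psi (bpair p q) r, names r y & f x y]].

Definition weihrauch_equiv (X Y U V : repSpace)
    (f : problem X Y) (g : problem U V) : Prop :=
  weihrauch_le f g /\ weihrauch_le g f.

Notation "f '<=_W' g" := (weihrauch_le f g) (at level 70, no associativity).
Notation "f '=_W' g" := (weihrauch_equiv f g) (at level 70, no associativity).

(* A number is named by its value at 0; the rest of the name is ignored. *)
Definition nat_names (p : baire) (n : nat) : Prop := p 0 = n.

Lemma nat_names_functional p m n : nat_names p m -> nat_names p n -> m = n.
Proof. by move=> <- <-. Qed.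

Lemma nat_names_surjective n : exists p, nat_names p n.
Proof. by exists (fun=> n). Qed.

Definition natSpace : repSpace :=
  RepSpace nat_names_functional nat_names_surjective.

Definition baire_names (p x : baire) : Prop := p = x.

Lemma baire_names_functional p x y : baire_names p x -> baire_names p y -> x = y.
Proof. by move=> <- <-. Qed.

Lemma baire_names_surjective x : exists p, baire_names p x.
Proof. by exists x. Qed.

Definition baireSpace : repSpace :=
  RepSpace baire_names_functional baire_names_surjective.

Record graph (T : Type) := Graph {
  adj : rel T;
  adj_sym : symmetric adj;
  adj_irr : irreflexive adj }.

Lemma graph_eq (T : Type) (G H : graph T) : adj G =2 adj H -> G = H.
Proof.
case: G H => [e es ei] [e' es' ei'] /= eqe.
have {}eqe : e = e' by apply/funext => x; apply/funext => y.
by subst e'; rewrite (Prop_irrelevance es es') (Prop_irrelevance ei ei').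
Qed.

(* [F] is isomorphic to an induced subgraph of [G]. *)
Definition embeds (T U : Type) (F : graph T) (G : graph U) : Prop :=
  exists2 h : T -> U, injective h & forall x y, adj G (h x) (h y) = adj F x y.

(* Graphs with vertex set N, named by the characteristic function of the set
   of (coded) pairs of adjacent vertices; booleans coerce to 0 and 1. *)
Definition ngraph_names (p : baire) (G : graph nat) : Prop :=
  forall i j, p (cpair i j) = adj G i j.

Lemma nat_of_bool_inj : injective nat_of_bool.
Proof. by case; case. Qed.

Lemma ngraph_names_functional p G H :
  ngraph_names p G -> ngraph_names p H -> G = H.
Proof.
by move=> pG pH; apply: graph_eq => i j; apply: nat_of_bool_inj; rewrite -pG pH.
Qed.

Lemma ngraph_names_surjective G : exists p, ngraph_names p G.
Proof.
exists (fun z => adj G (cfst z) (csnd z)) => i j.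
by rewrite /cfst /csnd /cpair Cantor.cancel_of_to.
Qed.

Definition ngraphSpace : repSpace :=
  RepSpace ngraph_names_functional ngraph_names_surjective.

(* Countable graphs: the vertex set is an arbitrary, possibly finite, subset
   of N. *)
Definition cgraph := {V : pred nat & graph {n : nat | V n}}.

Definition cgraph_adj (G : cgraph) (i j : nat) : bool :=
  if (insub i, insub j) is (Some u, Some v) then adj (projT2 G) u v else false.

(* A name consists of the characteristic functions of the vertex set and of
   the edge set. *)
Definition cgraph_names (p : baire) (G : cgraph) : Prop :=
  exists pV pE : baire,
    [/\ p = bpair pV pE,
        forall i, pV i = projT1 G i &
        forall i j, pE (cpair i j) = cgraph_adj G i j].

Lemma bpair_inj p q p' q' : bpair p q = bpair p' q' -> p = p' /\ q = q'.
Proof.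
move=> e; split; apply/funext => n.
- by have := congr1 (@^~ n.*2) e; rewrite /bpair odd_double doubleK.
- by have := congr1 (@^~ n.*2.+1) e; rewrite /bpair /= odd_double /= uphalf_double.
Qed.

Lemma cgraph_names_functional p G H :
  cgraph_names p G -> cgraph_names p H -> G = H.
Proof.
move=> [pV [pE [-> pVG pEG]]] [qV [qE [/bpair_inj[<- <-] pVH pEH]]].
case: G H pVG pEG pVH pEH => [V G] [W H] /= pVG pEG pVH pEH.
have eVW : V = W.
  by apply/funext => i; apply: nat_of_bool_inj; rewrite -pVG pVH.
subst W; congr existT; apply: graph_eq => u v; apply: nat_of_bool_inj.
by move: (pEG (val u) (val v)); rewrite pEH /cgraph_adj !valK /= => ->.
Qed.

Lemma cgraph_names_surjective G : exists p, cgraph_names p G.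
Proof.
exists (bpair (fun i => projT1 G i) (fun z => cgraph_adj G (cfst z) (csnd z))).
do 2 eexists; split=> // i j.
by rewrite /cfst /csnd /cpair Cantor.cancel_of_to.
Qed.

Definition cgraphSpace : repSpace :=
  RepSpace cgraph_names_functional cgraph_names_surjective.

Definition S_spec (T U : Type) (F : graph T) (G : graph U) (n : nat) : Prop :=
  (embeds F G /\ n = 1) \/ (~ embeds F G /\ n = 0).

Definition S_ (T : finType) (F : graph T) : problem ngraphSpace natSpace :=
  fun G n => S_spec F G n.

Definition S_countable (T : finType) (F : graph T) :
    problem cgraphSpace natSpace :=
  fun G n => S_spec F (projT2 G) n.

Definition LPO : problem baireSpace natSpace :=
  fun p n =>
    (n = 0 -> forall j, 0 < p j) /\
    (0 < n -> p n.-1 = 0 /\ forall t, t < n.-1 -> 0 < p t).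

(* Main.v *)
(** [F] embeds in [G] iff some code of a tuple of vertices of [G] passes a
    finite check, so [LPO] applied to the failures of that check decides
    embeddability.  Conversely, turn [p] into a graph that is edgeless if [F]
    has an edge and complete otherwise, as long as no zero of [p] shows up;
    among the vertices beyond a zero of [p], vertex [i] behaves like the vertex
    [i] mod [#|F|] of [F].  As [F] has two vertices, [F] embeds in this graph
    iff [p] has a zero, and then the first zero is found by unbounded search. *)

Require Import Defs.
From mathcomp Require Import all_boot.
From mathcomp Require Import boolp.
From Stdlib Require Import Arith.Cantor.

Set Implicit Arguments.
Unset Strict Implicit.
Unset Printing Implicit Defensive.

(** * Pairing and closure properties of computability relative to an oracle *)

Lemma cfst_cpair x y : cfst (cpair x y) = x.
Proof. by rewrite /cfst /cpair Cantor.cancel_of_to. Qed.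

Lemma csnd_cpair x y : csnd (cpair x y) = y.
Proof. by rewrite /csnd /cpair Cantor.cancel_of_to. Qed.

Lemma cpair_proj z : cpair (cfst z) (csnd z) = z.
Proof. by rewrite /cpair /cfst /csnd -surjective_pairing Cantor.cancel_to_of. Qed.

(** One program serves every oracle, as [Phi] and [Psi] in [weihrauch_le] must; boolean functions
    are covered through the coercion to 0 and 1. *)
Definition computable (f : baire -> nat -> nat) : Prop :=
  exists c : prog, forall o x, eval o c x (f o x).

Lemma computable_id : computable (fun=> id).
Proof.
(* Cantor pairing is onto, so pairing the two projections again is the identity. *)
exists (Pair Fst Snd) => o x /=.
by exists (cfst x), (csnd x); rewrite cpair_proj.
Qed.

Lemma computable_comp (u : nat -> nat) (f : baire -> nat -> nat) :
  computable (fun=> u) -> computable f -> computable (fun o x => u (f o x)).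
Proof. by move=> [d Hd] [c Hc]; exists (Comp d c) => o x /=; exists (f o x). Qed.

Lemma computable_subst (u f : baire -> nat -> nat) :
  computable u -> computable f -> computable (fun o x => u o (f o x)).
Proof. by move=> [d Hd] [c Hc]; exists (Comp d c) => o x /=; exists (f o x). Qed.

Lemma computable_succ f : computable f -> computable (fun o x => (f o x).+1).
Proof. by apply: computable_comp; exists Succ. Qed.

Lemma computable_fst f : computable f -> computable (fun o x => cfst (f o x)).
Proof. by apply: computable_comp; exists Fst. Qed.

Lemma computable_snd f : computable f -> computable (fun o x => csnd (f o x)).
Proof. by apply: computable_comp; exists Snd. Qed.

Lemma computable_oracle f : computable f -> computable (fun o x => o (f o x)).
Proof. by apply: (@computable_subst (fun o => o)); exists Oracle. Qed.

Lemma computable_pair f g :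
  computable f -> computable g -> computable (fun o x => cpair (f o x) (g o x)).
Proof.
by move=> [c Hc] [d Hd]; exists (Pair c d) => o x /=; exists (f o x), (g o x).
Qed.

Lemma computable_const n : computable (fun _ _ => n).
Proof. by elim: n => [|n /computable_succ//]; exists Zero. Qed.

(** The whole input [x] is the parameter of [Prec], so the step may depend on it. Branching,
    arithmetic and bounded search below are obtained from this scheme. *)
Lemma computable_rec (f n : baire -> nat -> nat)
    (g : baire -> nat -> nat -> nat -> nat) :
  computable f -> computable n ->
  computable (fun o z => g o (cfst z) (cfst (csnd z)) (csnd (csnd z))) ->
  computable (fun o x => nat_rect (fun=> nat) (f o x) (g o x) (n o x)).
Proof.
move=> [cf Hf] [cn Hn] [cg Hg].
have [ci Hi] := computable_id.
exists (Comp (Prec cf cg) (Pair ci cn)) => o x.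
exists (cpair x (n o x)); first by exists x, (n o x).
rewrite /= csnd_cpair cfst_cpair; elim: (n o x) => [|m IHm] //=.
eexists; first exact: IHm.
by have := Hg o (cpair x (cpair m (nat_rect (fun=> nat) (f o x) (g o x) m)));
  rewrite !(cfst_cpair, csnd_cpair).
Qed.

Lemma computable_ext f g : computable f -> f =2 g -> computable g.
Proof. by move=> [c Hc] fg; exists c => o x; rewrite -fg. Qed.

Lemma computable_if (b : baire -> nat -> bool) f g :
  computable b -> computable f -> computable g ->
  computable (fun o x => if b o x then f o x else g o x).
Proof.
move=> cb cf cg.
(* The boolean is the recursion bound: no step leaves [g], one step yields [f]. *)
apply: computable_ext (computable_rec (g := fun o x _ _ => f o x) cg cb _) _.
  exact: computable_subst cf (computable_fst computable_id).
by move=> o x; case: (b o x).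
Qed.

Lemma computable_negb (b : baire -> nat -> bool) :
  computable b -> computable (fun o x => ~~ b o x).
Proof.
move=> cb; apply: computable_ext
  (computable_if cb (computable_const 0) (computable_const 1)) _.
by move=> o x; case: (b o x).
Qed.

Lemma computable_andb (a b : baire -> nat -> bool) :
  computable a -> computable b -> computable (fun o x => a o x && b o x).
Proof.
move=> ca cb; apply: computable_ext (computable_if ca cb (computable_const 0)) _.
by move=> o x; case: (a o x).
Qed.

Lemma computable_orb (a b : baire -> nat -> bool) :
  computable a -> computable b -> computable (fun o x => a o x || b o x).
Proof.
move=> ca cb; apply: computable_ext (computable_if ca (computable_const 1) cb) _.
by move=> o x; case: (a o x).
Qed.

Lemma computable_eq0 f : computable f -> computable (fun o x => f o x == 0).
Proof.
move=> cf; apply: computable_ext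
  (computable_rec (g := fun _ _ _ _ => 0) (computable_const 1) cf _) _.
  exact: computable_const.
by move=> o x; case: (f o x).
Qed.

Lemma computable_pred f : computable f -> computable (fun o x => (f o x).-1).
Proof.
move=> cf; apply: computable_ext
  (computable_rec (g := fun _ _ m _ => m) (computable_const 0) cf _) _.
  exact/computable_fst/computable_snd/computable_id.
by move=> o x; case: (f o x).
Qed.

Lemma computable_sub f g :
  computable f -> computable g -> computable (fun o x => f o x - g o x).
Proof.
move=> cf cg; apply: computable_ext
  (computable_rec (g := fun _ _ _ r => r.-1) cf cg _) _.
  exact/computable_pred/computable_snd/computable_snd/computable_id.
by move=> o x; elim: (g o x) => [|m /= ->]; rewrite (subn0, subnS).
Qed.

Lemma computable_eqn f g :
  computable f -> computable g -> computable (fun o x => f o x == g o x).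
Proof.
move=> cf cg; apply: computable_ext (computable_andb
  (computable_eq0 (computable_sub cf cg)) (computable_eq0 (computable_sub cg cf))) _.
by move=> o x; rewrite [in RHS]eqn_leq.
Qed.

Lemma computable_all (A : Type) (s : seq A) (b : A -> baire -> nat -> bool) :
  (forall a, computable (b a)) ->
  computable (fun o x => all (fun a => b a o x) s).
Proof.
move=> cb; elim: s => [|a s IHs]; first exact: (computable_const 1).
exact: computable_andb.
Qed.

Lemma computable_has_iota (b : baire -> nat -> nat -> bool) n :
  computable (fun o z => b o (cfst z) (csnd z)) -> computable n ->
  computable (fun o x => has (b o x) (iota 0 (n o x))).
Proof.
move=> cb cn; apply: computable_ext (computable_rec
  (g := fun o x m r => ~~ (r == 0) || b o x m) (computable_const 0) cn _) _.
  apply: computable_orb.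
    exact/computable_negb/computable_eq0/computable_snd/computable_snd/computable_id.
  apply: computable_ext (computable_subst cb (computable_pair
    (computable_fst computable_id)
    (computable_fst (computable_snd computable_id)))) _.
  by move=> o x; rewrite cfst_cpair csnd_cpair.
move=> o x; elim: (n o x) => [|m IHm] //.
by rewrite [LHS]/= IHm -addn1 iotaD has_cat /= orbF; case: has.
Qed.

(** The programs for the [F i] need not be uniform in [i]: only values below [k] occur, so finitely
    many programs are glued by nested conditionals. *)
Lemma computable_case k g (F : nat -> baire -> nat -> nat) :
  computable g -> (forall i, computable (F i)) -> (forall o x, g o x < k) ->
  computable (fun o x => F (g o x) o x).
Proof.
move=> cg cF gk.
suff H n : computable (fun o x => if g o x < n then F (g o x) o x else 0).
  by apply: computable_ext (H k) _ => o x; rewrite gk.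
elim: n => [|n IHn]; first exact: (computable_const 0).
apply: computable_ext
  (computable_if (computable_eqn cg (computable_const n)) (cF n) IHn) _.
by move=> o x; rewrite [in RHS]ltnS [in RHS]leq_eqVlt; case: eqVneq => [->|].
Qed.

Lemma computable_mod k f : computable f -> computable (fun o x => f o x %% k.+1).
Proof.
move=> cf; apply: computable_ext (computable_rec
  (g := fun _ _ _ r => if r == k then 0 else r.+1) (computable_const 0) cf _) _.
  have cr : computable (fun=> csnd \o csnd).
    exact/computable_snd/computable_snd/computable_id.
  apply: computable_if; last exact: computable_succ.
    exact: computable_eqn cr (computable_const k).
  exact: computable_const.
move=> o x; elim: (f o x) => [|m /= ->]; first by rewrite mod0n.
rewrite -(addn1 m) -modnDml addn1; case: eqVneq => [->|nk]; first by rewrite modnn.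
by rewrite [RHS]modn_small // ltnS ltn_neqAle nk -ltnS ltn_mod.
Qed.

Lemma computable_odd f : computable f -> computable (fun o x => odd (f o x)).
Proof.
move=> cf; apply: computable_ext (computable_rec
  (g := fun _ _ _ r => r == 0) (computable_const 0) cf _) _.
  exact/computable_eq0/computable_snd/computable_snd/computable_id.
by move=> o x; elim: (f o x) => [|m /= ->] //; case: odd.
Qed.

Lemma computable_half f : computable f -> computable (fun o x => (f o x)./2).
Proof.
move=> cf; apply: computable_ext (computable_rec
  (g := fun _ _ m r => if odd m then r.+1 else r) (computable_const 0) cf _) _.
  have cr : computable (fun=> csnd \o csnd).
    exact/computable_snd/computable_snd/computable_id.
  apply: computable_if (computable_succ cr) cr.
  exact/computable_odd/computable_fst/computable_snd/computable_id.
move=> o x; elim: (f o x) => [|m /= ->] //.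
by rewrite uphalf_half; case: odd.
Qed.

Lemma computable_double f : computable f -> computable (fun o x => (f o x).*2).
Proof.
move=> cf; apply: computable_ext (computable_rec
  (g := fun _ _ _ r => r.+2) (computable_const 0) cf _) _.
  exact/computable_succ/computable_succ/computable_snd/computable_snd/computable_id.
by move=> o x; elim: (f o x) => [|m /= ->] //; rewrite doubleS.
Qed.

Lemma computable_bpair f g :
  computable f -> computable g -> computable (fun o => bpair (f o) (g o)).
Proof.
have chalf : computable (fun=> half) by apply/computable_half/computable_id.
move=> cf cg; apply: computable_if; first exact/computable_odd/computable_id.
  exact: computable_subst.
exact: computable_subst.
Qed.

Lemma bpair_double p q n : bpair p q n.*2 = p n.
Proof. by rewrite /bpair odd_double doubleK. Qed.

Lemma bpair_doubleS p q n : bpair p q n.*2.+1 = q n.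
Proof. by rewrite /bpair /= odd_double /= uphalf_double. Qed.

(** * [LPO] and decision problems *)

Lemma LPO_total (p : baire) : exists n, LPO p n.
Proof.
have [ex0|no0] := pselect (exists n, p n == 0); last first.
  by exists 0; split=> // _ j; rewrite lt0n; apply/negP => pj; apply: no0; exists j.
case: (ex_minnP ex0) => m /eqP pm m_min; exists m.+1; split=> //= _.
split=> // t tm; rewrite lt0n; apply: contraL tm => /m_min.
by rewrite leqNgt.
Qed.

Lemma LPO_gt0 (p : baire) n : LPO p n -> 0 < n <-> exists m, p m = 0.
Proof.
case: n => [|n] [H0 H1].
  by split=> // -[m pm]; have := H0 erefl m; rewrite pm.
by split=> // _; exists n; case: (H1 isT).
Qed.

(** [S_ F] and [S_countable F] unfold to instances of this problem, so they share the two reductions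
    that follow. *)
Definition decision (X : repSpace) (P : X -> Prop) : problem X natSpace :=
  fun x n => (P x /\ n = 1) \/ (~ P x /\ n = 0).

(** The sequence [w p] is itself the instance of [LPO], and by [LPO_gt0] the sign of the answer
    decides [P]. *)
Lemma decision_le_LPO (X : repSpace) (P : X -> Prop) (w : baire -> nat -> nat) :
  computable w ->
  (forall p x, names p x -> P x <-> exists n, w p n = 0) ->
  decision P <=_W LPO.
Proof.
move=> [Phi HPhi] Pw.
(* Position 1 of [bpair p q] holds [q 0], the answer of [LPO]. *)
have [Psi HPsi] : computable (fun o _ => ~~ (o 1 == 0)).
  exact/computable_negb/computable_eq0/computable_oracle/computable_const.
exists Phi, Psi => p x px _; exists (w p), (w p); split=> //; first exact: LPO_total.
move=> q n qn wn; exists (fun=> ~~ (q 0 == 0) : nat), (nat_of_bool (~~ (q 0 == 0))).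
split=> //.
have {qn}-> : q 0 = n by [].
have [lpo1 lpo2] := LPO_gt0 wn; have [P1 P2] := Pw _ _ px.
rewrite -lt0n /decision; case: posnP => [n0|n_gt0] /=; last by left; split=> //; auto.
by right; split=> // /P1 /lpo2; rewrite n0.
Qed.

(** One bit suffices because [Psi] still has access to [p]: once the answer 1 guarantees a zero,
    unbounded search for the first one terminates. *)
Lemma LPO_le_decision (X : repSpace) (P : X -> Prop)
    (w : baire -> nat -> nat) (enc : baire -> X) :
  computable w -> (forall p, names (w p) (enc p)) ->
  (forall p, P (enc p) <-> exists n, p n = 0) ->
  LPO <=_W decision P.
Proof.
move=> [Phi HPhi] w_enc P_enc.
(* [even] reads [p] off the even positions of the oracle, at the candidate that [Mu] puts in the
   second component. *)
have [even Heven] : computable (fun o z => o (csnd z).*2).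
  exact/computable_oracle/computable_double/computable_snd/computable_id.
have [arg Harg] : computable (fun o _ => cpair 0 (o 1)).
  exact: computable_pair (computable_const _) (computable_oracle (computable_const _)).
(* [Prec] serves as a lazy conditional: the search is started only if the
   answer of the decision problem is 1. *)
exists Phi, (Comp (Prec Zero (Comp Succ (Mu even))) arg).
move=> p x px _; have {x px}<- : p = x by [].
exists (w p), (enc p); split=> //.
  have [Pp|nPp] := pselect (P (enc p)); first by exists 1; left.
  by exists 0; right.
move=> q v qv Pv; have [n pn] := LPO_total p.
exists (fun=> n), n; split=> // k /=.
exists (cpair 0 (bpair p q 1)); first exact: Harg (bpair p q) _.
rewrite csnd_cpair cfst_cpair.
have {qv}-> : bpair p q 1 = v by [].
have [lpo1 lpo2] := LPO_gt0 pn; have [P1 P2] := P_enc p.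
case: Pv => [[/P1/lpo2 n_gt0 ->]|[nP ->]] /=; last first.
  by case: n {pn lpo2} lpo1 => // n /(_ isT)/P2.
(* With bound 1 a single step follows the base value 0; the search stops at [n.-1], as a positive
   answer of [LPO] is the position of the first zero plus one. *)
exists 0 => //; exists n.-1; last by rewrite prednK.
have [_ /(_ n_gt0)[pn0 p_gt0]] := pn.
have Hp x m : eval (bpair p q) even (cpair x m) (p m).
  by have := Heven (bpair p q) (cpair x m); rewrite csnd_cpair bpair_double.
split=> [|m /p_gt0 pm]; first by rewrite -pn0.
by exists (p m).-1; rewrite prednK.
Qed.

(** * Coding finite tuples and checking embeddings *)

Definition coord (i n : nat) : nat := cfst (iter i csnd n).

Lemma computable_coord i : computable (fun=> coord i).
Proof.
apply: computable_fst; elim: i => [|i IHi]; first exact: computable_id.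
exact: computable_snd IHi.
Qed.

(** Codes are right-nested pairs: pairing [h 0] with a code of the tail moves every coordinate of
    the tail up by one. *)
Lemma coord_onto k (h : nat -> nat) :
  exists n, forall i, i < k -> coord i n = h i.
Proof.
elim: k h => [|k IHk] h; first by exists 0.
have [n Hn] := IHk (h \o succn).
exists (cpair (h 0) n) => -[_|i ik]; first exact: cfst_cpair.
by rewrite /coord iterSr csnd_cpair; exact: Hn.
Qed.

Section Witness.
Variables (T : finType) (F : graph T).
Variables (vert : baire -> nat -> bool) (edge : baire -> nat -> nat).

Let vertex (x : T) (n : nat) := coord (enum_rank x) n.

(** Here [n] is read as a map on [T], listed along [enum_rank]; [vert] and [edge] stay abstract to
    cover both kinds of names. *)
Definition witness (o : baire) (n : nat) : bool :=
  all (fun x => all (fun y =>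
    [&& vert o (vertex x n), (vertex x n == vertex y n) == (x == y) :> nat
      & edge o (cpair (vertex x n) (vertex y n)) == adj F x y :> nat])
    (enum T)) (enum T).

Lemma computable_witness :
  computable vert -> computable edge -> computable witness.
Proof.
move=> cv ce; apply: computable_all => x; apply: computable_all => y.
apply: computable_andb; first exact: computable_subst cv (computable_coord _).
apply: computable_andb; apply: computable_eqn; try exact: computable_const.
  by apply: computable_eqn; apply: computable_coord.
exact: computable_subst ce (computable_pair (computable_coord _) (computable_coord _)).
Qed.

(** A map out of the finite type [T] is a tuple of length [#|T|], so by [coord_onto] some number
    codes it. *)
Lemma witnessP o :
  (exists h : T -> nat,
     [/\ injective h, forall x, vert o (h x)
       & forall x y, edge o (cpair (h x) (h y)) = adj F x y]) <->
  exists n, witness o n.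
Proof.
split=> [[h [h_inj h_vert h_edge]]|[n /allP wn]].
  have [/card0_eq T0|T_gt0] := posnP #|T|.
    by exists 0; apply/allP => x; have := T0 x.
  (* [h'] lists the values of [h] along the enumeration of [T]; the default 0 lies beyond the
     coordinates that are read. *)
  pose h' i := if insub i is Some j then h (enum_val (j : 'I_#|T|)) else 0.
  have [n Hn] := coord_onto #|T| h'.
  have vE x : vertex x n = h x.
    by rewrite /vertex Hn // /h' valK enum_rankK.
  exists n; apply/allP => x _; apply/allP => y _.
  by rewrite !vE h_vert h_edge (inj_eq h_inj) !eqxx.
have {}wn x y := allP (wn x (mem_enum _ x)) y (mem_enum _ y).
exists (vertex^~ n); split=> [x y /= xy|x|x y].
- by have /and3P[_ + _] := wn x y; rewrite xy eqxx; case: (x =P y).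
- by have /and3P[] := wn x x.
- by have /and3P[_ _ /eqP] := wn x y.
Qed.

End Witness.

(** * Reductions of the subgraph problems to [LPO] *)

Lemma S_le_LPO (T : finType) (F : graph T) : S_ F <=_W LPO.
Proof.
(* Every number is a vertex and the name itself lists the edges; [witness] is negated below because
   [LPO] looks for zeros. *)
pose v (_ : baire) (_ : nat) := true; pose e (o : baire) := o.
apply: (@decision_le_LPO ngraphSpace (embeds F)
  (fun o n => ~~ witness F v e o n)).
  apply/computable_negb/computable_witness; first exact: (computable_const 1).
  by exists Oracle.
move=> p G pG; transitivity (exists n, witness F v e p n); last first.
  by split=> -[n wn]; exists n; move: wn; case: witness.
rewrite -witnessP; split=> [[h h_inj hE]|[h [h_inj _ hE]]]; exists h => //.
  by split=> // x y; rewrite /e pG hE.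
by move=> x y; apply: nat_of_bool_inj; rewrite -pG -hE.
Qed.

(** Trades maps into the subtype of vertices for plain maps into [nat], the form that [witnessP]
    handles. *)
Lemma embeds_cgraph (T : Type) (F : graph T) (G : cgraph) :
  embeds F (projT2 G) <->
  exists h : T -> nat,
    [/\ injective h, forall x, projT1 G (h x)
      & forall x y, cgraph_adj G (h x) (h y) = adj F x y].
Proof.
split=> [[h h_inj hE]|[h [h_inj hV hE]]].
  exists (val \o h); split=> [|x|x y]; first exact: inj_comp val_inj h_inj.
    exact: (valP (h x)).
  by rewrite /cgraph_adj /= !valK hE.
exists (fun x => exist _ (h x) (hV x)) => [x y [/h_inj]|x y] //.
by rewrite -hE /cgraph_adj !insubT.
Qed.

Lemma S_countable_le_LPO (T : finType) (F : graph T) : S_countable F <=_W LPO.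
Proof.
(* A name of a countable graph interleaves vertices at even and edges at odd positions. *)
pose v (o : baire) n := ~~ (o n.*2 == 0); pose e (o : baire) n := o n.*2.+1.
apply: (@decision_le_LPO cgraphSpace (fun G => embeds F (projT2 G))
  (fun o n => ~~ witness F v e o n)).
  apply/computable_negb/computable_witness.
    exact/computable_negb/computable_eq0/computable_oracle/computable_double/computable_id.
  exact/computable_oracle/computable_succ/computable_double/computable_id.
move=> _ G [pV [pE [-> pVG pEG]]].
transitivity (exists n, witness F v e (bpair pV pE) n); last first.
  by split=> -[n wn]; exists n; move: wn; case: witness.
have vE i : v (bpair pV pE) i = projT1 G i.
  by rewrite /v bpair_double pVG; case: (projT1 G i).
rewrite -witnessP embeds_cgraph.
split=> -[h [h_inj hV hE]]; exists h; split=> //.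
- by move=> x; rewrite vE.
- by move=> x y; rewrite /e bpair_doubleS pEG hE.
- by move=> x; rewrite -vE.
- by move=> x y; apply: nat_of_bool_inj; rewrite -pEG -hE /e bpair_doubleS.
Qed.

(** * The graph built from an instance of [LPO] *)

Section ZeroGraph.
Variables (T : finType) (F : graph T) (x0 : T).

Definition seen (p : baire) (i : nat) : bool := has (fun t => p t == 0) (iota 0 i.+1).

Definition edgeless : bool := [forall x, forall y, ~~ adj F x y].

(** The modulus is displayed as a successor to fit [computable_mod]; it equals [#|T|] since [T]
    contains [x0]. *)
Definition residue (i : nat) : T := nth x0 (enum T) (i %% #|T|.-1.+1).

(** Adjacency of [i] and [j] depends on [p] only up to the larger index, hence is computable
    although the existence of a zero is not decidable. *)
Definition zero_rel (p : baire) (i j : nat) : bool :=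
  if seen p i && seen p j then adj F (residue i) (residue j)
  else edgeless && (i != j).

Lemma zero_rel_sym p : symmetric (zero_rel p).
Proof. by move=> i j; rewrite /zero_rel andbC adj_sym eq_sym. Qed.

Lemma zero_rel_irr p : irreflexive (zero_rel p).
Proof. by move=> i; rewrite /zero_rel adj_irr eqxx andbF if_same. Qed.

Definition zero_graph (p : baire) : graph nat :=
  Graph (zero_rel_sym p) (zero_rel_irr p).

Lemma computable_zero_rel : computable (fun p z => zero_rel p (cfst z) (csnd z)).
Proof.
have cfstz : computable (fun=> cfst) by apply/computable_fst/computable_id.
have csndz : computable (fun=> csnd) by apply/computable_snd/computable_id.
have cseen : computable seen.
  apply: (computable_has_iota (b := fun p _ t => p t == 0)).
    exact/computable_eq0/computable_oracle.
  exact/computable_succ/computable_id.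
have cmod f : computable f -> computable (fun o x => f o x %% #|T|.-1.+1).
  exact: computable_mod.
apply: computable_ext (computable_if (b := fun p z => seen p (cfst z) && seen p (csnd z))
  (f := fun _ z => adj F (residue (cfst z)) (residue (csnd z)))
  (g := fun _ z => edgeless && (cfst z != csnd z)) _ _ _) _.
- by apply: computable_andb; apply: computable_subst cseen _.
(* Adjacency of two residues is a finite table, looked up by two nested case distinctions. *)
- apply: (computable_case (k := #|T|.-1.+1)
    (F := fun i _ z => adj F (nth x0 (enum T) i) (residue (csnd z))) (cmod _ cfstz)).
    move=> i; apply: (computable_case (k := #|T|.-1.+1)
      (F := fun j _ _ => adj F (nth x0 (enum T) i) (nth x0 (enum T) j)) (cmod _ csndz)).
      by move=> j; apply: computable_const.
    by move=> o x; rewrite ltn_mod.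
  by move=> o x; rewrite ltn_mod.
- apply: (computable_andb (a := fun _ _ => edgeless)); first exact: computable_const.
  exact/computable_negb/computable_eqn.
- by move=> p z; rewrite /zero_rel; case: ifP.
Qed.

(** Without a zero, the graph is complete or edgeless, chosen to disagree with [F] on some pair of
    distinct vertices. With a zero, a block of [#|T|] consecutive vertices beyond it is a copy of
    [F]. *)
Lemma embeds_zero_graph (p : baire) :
  1 < #|T| -> embeds F (zero_graph p) <-> exists n, p n = 0.
Proof.
move=> T_gt1; have T_gt0 := ltnW T_gt1; split=> [[h h_inj hE]|[n pn]].
  apply: contrapT => no0.
  have seenF i : seen p i = false.
    by apply/hasP => -[t _ /eqP pt]; apply: no0; exists t.
  have {}hE x y : edgeless && (x != y) = adj F x y.
    by rewrite -hE /= /zero_rel seenF (inj_eq h_inj).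
  (* If [F] had an edge, [hE] would leave it without edges; if it has none, [hE] joins two distinct
     vertices. *)
  have [el|nel] := boolP edgeless; last first.
    by case/negP: (nel); apply/'forall_forallP => x y; rewrite -hE (negPf nel).
  have /card_gt1P[x [y [_ _ xy]]] := T_gt1.
  by have /'forall_forallP/(_ x y) := el; rewrite -hE el xy.
(* Adding a multiple of [#|T|] preserves residues, and [n * #|T|] is at least [n], so the block lies
   beyond the zero. *)
pose h (x : T) : nat := n * #|T| + enum_rank x.
have hS x : seen p (h x).
  apply/hasP; exists n; last by rewrite pn.
  by rewrite mem_iota /= add0n ltnS (leq_trans (leq_pmulr n T_gt0)) ?leq_addr.
have hR x : residue (h x) = x.
  by rewrite /residue prednK // modnMDl modn_small // -[RHS]enum_rankK -enum_val_nth.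
exists h => [x y /addnI/val_inj/enum_rank_inj|x y] //=.
by rewrite /zero_rel !hS !hR.
Qed.

End ZeroGraph.

(** * Reductions of [LPO] to the subgraph problems *)

Lemma LPO_le_S (T : finType) (F : graph T) : 1 < #|T| -> LPO <=_W S_ F.
Proof.
move=> T_gt1; have /card_gt1P[x0 _] := T_gt1.
apply: (@LPO_le_decision ngraphSpace (embeds F) _ (zero_graph F x0)
  (computable_zero_rel F x0)) => p.
  by move=> i j /=; rewrite cfst_cpair csnd_cpair.
exact: embeds_zero_graph.
Qed.

Definition total_pred : pred nat := fun=> true.

(** Lets [zero_graph] serve for [S_countable] as well. *)
Definition cgraph_of (G : graph nat) : cgraph :=
  existT (fun V : pred nat => graph {n : nat | V n}) total_pred
    (Graph (adj := relpre (@proj1_sig nat total_pred) (adj G))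
       (fun u v => adj_sym G (val u) (val v)) (fun u => adj_irr G (val u))).

Lemma cgraph_of_adj G : cgraph_adj (cgraph_of G) =2 adj G.
Proof. by move=> i j; rewrite /cgraph_adj !insubT. Qed.

Lemma embeds_cgraph_of (T : Type) (F : graph T) (G : graph nat) :
  embeds F (projT2 (cgraph_of G)) <-> embeds F G.
Proof.
rewrite embeds_cgraph; split=> [[h [h_inj _ hE]]|[h h_inj hE]]; exists h => //.
  by move=> x y; rewrite -cgraph_of_adj.
by split=> // x y; rewrite cgraph_of_adj.
Qed.

Lemma LPO_le_S_countable (T : finType) (F : graph T) :
  1 < #|T| -> LPO <=_W S_countable F.
Proof.
move=> T_gt1; have /card_gt1P[x0 _] := T_gt1.
(* The constant 1 is the characteristic function of the full vertex set. *)
apply: (@LPO_le_decision cgraphSpace (fun G => embeds F (projT2 G)) _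
  (fun p => cgraph_of (zero_graph F x0 p))
  (computable_bpair (computable_const 1) (computable_zero_rel F x0))) => p.
  do 2 eexists; split=> // i j.
  by rewrite cgraph_of_adj cfst_cpair csnd_cpair.
by rewrite embeds_cgraph_of; exact: embeds_zero_graph.
Qed.

Theorem theorem28 (T : finType) (F : graph T) (hF : 1 < #|T|) :
  S_ F =_W LPO /\ S_countable F =_W LPO.
Proof.
split; split.
- exact: S_le_LPO.
- exact: LPO_le_S.
- exact: S_countable_le_LPO.
- exact: LPO_le_S_countable.
Qed.
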